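(* Let $x$ be a formal variable and let $K(v)=2x^2-3x(x+1)v+(5x+1)v^2-2(x+1)v^3+v^4$. The equation $K(v)=0$ has two solutions $v_1,v_2$ that are formal power series in $x$ with constant term $1$, namely $v_1=1+\frac{-1+\sqrt5}{2}x+\frac{-5+4\sqrt5}{5}x^2+\cdots$ and $v_2=1+\frac{-1-\sqrt5}{2}x+\frac{-5-4\sqrt5}{5}x^2+\cdots$. Then $$\sum_{n\ge 1}|\mathbf{I}_n(120,201,210)|\,x^n = -\frac{(v_1+v_2-2x-1)v_1v_2}{v_1v_2(v_1+v_2)-2(1+x)v_1v_2+2x} = x+2x^2+6x^3+23x^4+101x^5+484x^6+2468x^7+\cdots,$$ where $\mathbf{I}_n(120,201,210)$ is the set of inversion sequences of length $n$ avoiding $120$, $201$, and $210$ (equivalently, the inversion sequences of length $n$ sortable by a $(2,1)$-pop stack of depth two).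
   Context: An inversion sequence of length $n$ is a word $e_1\cdots e_n$ of integers with $0\le e_i\le i-1$. A word $w$ contains a pattern $p=p_1\cdots p_m$ if it has a subsequence $w_{\alpha_1}\cdots w_{\alpha_m}$ ($\alpha_1<\cdots<\alpha_m$) with $w_{\alpha_i}<w_{\alpha_j}$ iff $p_i<p_j$ and $w_{\alpha_i}=w_{\alpha_j}$ iff $p_i=p_j$; otherwise it avoids $p$. A $(2,1)$-pop stack of depth two is a pop stack (pops empty the whole device, top to bottom, to the output) whose contents contain at most two distinct values at any time and in which a new entry may be pushed either on top or directly below the topmost block of equal values; a word is sortable by it if some admissible sequence of operations outputs the entries in weakly increasing order.
   Formalization: The displayed quotient is false at v1, v2 (it starts 1/x); it is proved instead at the two roots of K with constant term 0, and in v1, v2 the generating function is shown to be x(v1+v2-1)/(v1v2-x(v1+v2)). *)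

(* Defs.v *)
From HB Require Import structures.
From mathcomp Require Import all_boot all_order all_algebra.
From mathcomp Require Import boolp.

Set Implicit Arguments.
Unset Strict Implicit.
Unset Printing Implicit Defensive.

Import Order.TTheory GRing.Theory Num.Theory.

Local Open Scope ring_scope.

(* Formal power series over R. A record rather than an alias of [nat -> R],   *)
(* so that the product is never confused with a pointwise one.                *)
Record fps (R : Type) : Type := Fps { fcoef : nat -> R }.

Lemma fpsP (R : Type) (f g : fps R) : fcoef f =1 fcoef g <-> f = g.
Proof. by split=> [|-> //]; case: f g => [f] [g] /= /funext ->. Qed.

HB.instance Definition _ (R : Type) := gen_eqMixin (fps R).
HB.instance Definition _ (R : Type) := gen_choiceMixin (fps R).

Definition fps_zero (R : comNzRingType) : fps R := Fps (fun=> 0).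
Definition fps_opp (R : comNzRingType) (f : fps R) : fps R :=
  Fps (fun n => - fcoef f n).
Definition fps_add (R : comNzRingType) (f g : fps R) : fps R :=
  Fps (fun n => fcoef f n + fcoef g n).
Definition fps_one (R : comNzRingType) : fps R := Fps (fun n => (n == 0%N)%:R).
Definition fps_mul (R : comNzRingType) (f g : fps R) : fps R :=
  Fps (fun n => \sum_(i < n.+1) fcoef f i * fcoef g (n - i)%N).
Definition fpsX (R : comNzRingType) : fps R := Fps (fun n => (n == 1%N)%:R).

Fact fps_addA (R : comNzRingType) : associative (@fps_add R).
Proof. by move=> f g h; apply/fpsP=> n; rewrite /= addrA. Qed.
Fact fps_addC (R : comNzRingType) : commutative (@fps_add R).
Proof. by move=> f g; apply/fpsP=> n; rewrite /= addrC. Qed.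
Fact fps_add0 (R : comNzRingType) : left_id (fps_zero R) (@fps_add R).
Proof. by move=> f; apply/fpsP=> n; rewrite /= add0r. Qed.
Fact fps_addN (R : comNzRingType) :
  left_inverse (fps_zero R) (@fps_opp R) (@fps_add R).
Proof. by move=> f; apply/fpsP=> n; rewrite /= addNr. Qed.

HB.instance Definition _ (R : comNzRingType) :=
  GRing.isZmodule.Build (fps R) (@fps_addA R) (@fps_addC R) (@fps_add0 R)
    (@fps_addN R).

Fact fps_mulC (R : comNzRingType) : commutative (@fps_mul R).
Proof.
move=> f g; apply/fpsP=> n /=; rewrite (reindex_inj rev_ord_inj) /=.
by apply: eq_bigr => i _; rewrite subSS subKn ?leq_ord // mulrC.
Qed.

Fact fps_mul_rev (R : comNzRingType) (f g : fps R) n :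
  fcoef (fps_mul f g) n = \sum_(i < n.+1) fcoef f (n - i)%N * fcoef g i.
Proof.
by rewrite fps_mulC /=; apply: eq_bigr => i _; rewrite mulrC.
Qed.

Fact fps_mulA (R : comNzRingType) : associative (@fps_mul R).
Proof.
move=> f g h; apply/fpsP=> i; rewrite [RHS]fps_mul_rev.
pose coef3 j k := fcoef f j * (fcoef g (i - j - k)%N * fcoef h k).
transitivity (\sum_(j < i.+1) \sum_(k < i.+1 | (k <= i - j)%N) coef3 j k).
  apply: eq_bigr => j _; rewrite fps_mul_rev big_distrr /=.
  by rewrite (big_ord_narrow_leq (leq_subr _ _)).
rewrite (exchange_big_dep predT) //=; apply: eq_bigr => k _.
transitivity (\sum_(j < i.+1 | (j <= i - k)%N) coef3 j k).
  apply: eq_bigl => j; rewrite -ltnS -(ltnS j) -!subSn ?leq_ord //.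
  by rewrite -subn_gt0 -(subn_gt0 j) -!subnDA addnC.
rewrite (big_ord_narrow_leq (leq_subr _ _)) big_distrl /=.
by apply: eq_bigr => j _; rewrite /coef3 -!subnDA addnC mulrA.
Qed.

Fact fps_mul1 (R : comNzRingType) : left_id (fps_one R) (@fps_mul R).
Proof.
move=> f; apply/fpsP=> n /=; rewrite big_ord_recl subn0 mul1r.
by rewrite big1 ?addr0 // => i _; rewrite mul0r.
Qed.

Fact fps_mulDl (R : comNzRingType) :
  left_distributive (@fps_mul R) (@fps_add R).
Proof.
move=> f g h; apply/fpsP=> n /=; rewrite -big_split.
by apply: eq_bigr => i _; rewrite mulrDl.
Qed.

Fact fps_one_neq0 (R : comNzRingType) : fps_one R != 0.
Proof.
by apply/eqP => /fpsP /(_ 0%N) /= /eqP; rewrite oner_eq0.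
Qed.

HB.instance Definition _ (R : comNzRingType) :=
  GRing.Zmodule_isComNzRing.Build (fps R) (@fps_mulA R) (@fps_mulC R)
    (@fps_mul1 R) (@fps_mulDl R) (@fps_one_neq0 R).

Definition fps_unit (R : idomainType) : {pred fps R} :=
  fun f => `[< exists g, g * f = 1 >].
Definition fps_inv (R : idomainType) (f : fps R) : fps R :=
  if pselect (exists g, g * f = 1) is left h then projT1 (cid h) else f.

Fact fps_mulV (R : idomainType) :
  {in @fps_unit R, left_inverse 1 (@fps_inv R) *%R}.
Proof.
move=> f /asboolP ex; rewrite /fps_inv; case: pselect => [h|//].
exact: projT2 (cid h).
Qed.
Fact fps_unitP (R : idomainType) (f g : fps R) : g * f = 1 -> fps_unit f.
Proof. by move=> h; apply/asboolP; exists g. Qed.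
Fact fps_inv_out (R : idomainType) :
  {in [predC @fps_unit R], @fps_inv R =1 id}.
Proof.
move=> f nU; rewrite /fps_inv; case: pselect => [h|//].
by case/negP: nU; apply/asboolP.
Qed.

HB.instance Definition _ (R : idomainType) :=
  GRing.ComNzRing_hasMulInverse.Build (fps R) (@fps_mulV R) (@fps_unitP R)
    (@fps_inv_out R).

Fact fps_low (R : idomainType) (f : fps R) : f != 0 ->
  exists2 m, fcoef f m != 0 & forall i, (i < m)%N -> fcoef f i = 0.
Proof.
move=> f0; have ex : exists m, fcoef f m != 0.
  apply: contrapT => h; case/eqP: f0; apply/fpsP => n.
  by apply: contrapT => fn; apply: h; exists n; apply/eqP.
case: (ex_minnP ex) => m fm minm; exists m => // i lim.
by apply/eqP; apply: contraTT lim => /minm; rewrite -leqNgt.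
Qed.

Fact fps_idomain (R : idomainType) (f g : fps R) :
  f * g = 0 -> (f == 0) || (g == 0).
Proof.
move=> fg0; apply/negPn/negP; rewrite negb_or => /andP[].
move=> /fps_low[m fm lm] /fps_low[k gk lk].
have /fpsP/(_ (m + k)%N) /= := fg0.
have lem : (m < (m + k).+1)%N by rewrite ltnS leq_addr.
rewrite (bigD1 (Ordinal lem)) //= big1 => [|i ne].
  by rewrite addr0 addKn => /eqP; rewrite mulf_eq0 (negPf fm) (negPf gk).
have [lt|ge] := ltnP i m; first by rewrite lm // mul0r.
rewrite [X in _ * X]lk ?mulr0 //; have lt : (m < i)%N.
  by rewrite ltn_neqAle ge andbT eq_sym; apply: contra ne => /eqP e; apply/eqP/val_inj.
by rewrite ltn_subLR ?ltn_add2r // -ltnS.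
Qed.

HB.instance Definition _ (R : idomainType) :=
  GRing.ComUnitRing_isIntegral.Build (fps R) (@fps_idomain R).

(* Quotients of power series are taken in the fraction field of R[[x]], since *)
(* a denominator may have zero constant term.                                 *)
Definition fps_quot (R : idomainType) (N D : fps R) : {fraction (fps R)} :=
  FracField.tofrac N / FracField.tofrac D.

Definition contains (w p : seq nat) : bool :=
  [exists a : {ffun 'I_(size p) -> 'I_(size w)},
    [forall i : 'I_(size p), forall j : 'I_(size p),
      [&& (i < j)%N ==> (a i < a j)%N,
          (nth 0%N w (a i) < nth 0%N w (a j))%N
            == (nth 0%N p i < nth 0%N p j)%N
        & (nth 0%N w (a i) == nth 0%N w (a j))
            == (nth 0%N p i == nth 0%N p j)]]].

(* Positions are numbered from 0, so that the i-th entry is at most i. *)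
Definition invseq (n : nat) : {set n.-tuple 'I_n} :=
  [set e : n.-tuple 'I_n | [forall i : 'I_n, (tnth e i <= i)%N]].

Definition word (n : nat) (e : n.-tuple 'I_n) : seq nat :=
  [seq val a | a <- e].

Definition pats : seq (seq nat) :=
  [:: [:: 1; 2; 0]; [:: 2; 0; 1]; [:: 2; 1; 0]]%N.

Definition invseq_avoid (n : nat) (ps : seq (seq nat)) :
    {set n.-tuple 'I_n} :=
  [set e in invseq n | all (fun p => ~~ contains (word e) p) ps].

(* Stack contents are listed from top to bottom. *)
Definition push_below (x : nat) (st : seq nat) : seq nat :=
  let k := find (fun y => y != head x st) st in take k st ++ x :: drop k st.

Definition fits (st : seq nat) : bool := (size (undup st) <= 2)%N.

(* [popstack inp st out res]: from remaining input [inp], contents [st] and   *)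
(* output so far [out], some sequence of operations ends with input and stack *)
(* empty and output [res].                                                    *)
Inductive popstack : seq nat -> seq nat -> seq nat -> seq nat -> Prop :=
| popstack_done out : popstack [::] [::] out out
| popstack_pop inp st out res :
    popstack inp [::] (out ++ st) res -> popstack inp st out res
| popstack_top x inp st out res :
    fits (x :: st) ->
    popstack inp (x :: st) out res -> popstack (x :: inp) st out res
| popstack_below x inp st out res :
    fits (x :: st) ->
    popstack inp (push_below x st) out res -> popstack (x :: inp) st out res.

Definition sortable (w : seq nat) : Prop :=
  exists2 res, popstack w [::] [::] res & sorted leq res.

Definition invseq_gf (R : comNzRingType) : fps R :=
  Fps (fun n => if n is 0%N then 0 else #|invseq_avoid n pats|%:R).

Definition kernel (R : comNzRingType) (v : fps R) : fps R :=
  let x := fpsX R in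
  2 * x ^+ 2 - 3 * x * (x + 1) * v + (5 * x + 1) * v ^+ 2
    - 2 * (x + 1) * v ^+ 3 + v ^+ 4.

Definition root_formula (R : idomainType) (u1 u2 : fps R) :
    {fraction (fps R)} :=
  let x := fpsX R in
  - fps_quot ((u1 + u2 - 2 * x - 1) * (u1 * u2))
      (u1 * u2 * (u1 + u2) - 2 * (1 + x) * (u1 * u2) + 2 * x).

(* The formula is published with u1, u2 the roots of constant term 1. No      *)
(* nonzero power series satisfies it then: at x = 0 the denominator vanishes  *)
(* and the numerator is 1. It holds for the two roots of constant term 0.     *)
Lemma root_formula_const1 (R : idomainType) (u1 u2 g : fps R) :
  g != 0 -> fcoef u1 0 = 1 -> fcoef u2 0 = 1 ->
  FracField.tofrac g <> root_formula u1 u2.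
Proof.
move=> g0 h1 h2; rewrite /root_formula /fps_quot.
have c0M (f h : fps R) : fcoef (f * h) 0 = fcoef f 0 * fcoef h 0.
  by rewrite /= big_ord_recl big_ord0 addr0.
have c0D (f h : fps R) : fcoef (f + h) 0 = fcoef f 0 + fcoef h 0 by [].
have c0N (f : fps R) : fcoef (- f) 0 = - fcoef f 0 by [].
have c01 : fcoef (1 : fps R) 0 = 1 by [].
have c0X : fcoef (fpsX R) 0 = 0 by [].
have c02 : fcoef (2 : fps R) 0 = 2 by [].
set N := _ * (u1 * u2); set D := _ + 2 * _.
have N0 : fcoef N 0 = 1.
  rewrite /N !(c0M, c0D, c0N, h1, h2, c01, c0X) !(mulr0, subr0, mulr1).
  by rewrite addrK.
have D0 : fcoef D 0 = 0.
  rewrite /D !(c0M, c0D, c0N, h1, h2, c01, c02, c0X).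
  by rewrite !(mulr0, addr0, mulr1, mul1r) subrr.
have [DE|Dn] := eqVneq D 0.
  by rewrite DE tofrac0 invr0 mulr0 oppr0 => /eqP; rewrite tofrac_eq0 (negPf g0).
move=> /(congr1 (fun q => q * FracField.tofrac D)).
rewrite mulNr mulfVK ?tofrac_eq0 // -tofracM -tofracN => /eqP.
rewrite tofrac_eq => /eqP /(congr1 (fun f => fcoef f 0)).
rewrite c0M c0N D0 N0 mulr0 => /eqP.
by rewrite eq_sym oppr_eq0 oner_eq0.
Qed.

(* Main.v *)
(* A word avoids 120, 201 and 210 iff, for every letter, the smaller letters  *)
(* after it are all equal and the larger letters before it are all equal.     *)
(* Such words are recognised letter by letter from the triple [state] below,  *)
(* and an accepting run is a strategy for the pop stack: the larger of the    *)
(* two values is kept at the bottom, and a new maximum triggers a pop.        *)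
(*                                                                            *)
(* For inversion sequences, mark by V the number n - m of letters above the   *)
(* current maximum m that may come next. The generating function f(V) then    *)
(* satisfies a linear equation with coefficient V^4 K(1/V) and unknowns f(1)  *)
(* and f'(1). It may be evaluated at V = 1/v for the two roots v of K with    *)
(* constant term 1, and eliminating f'(1) gives f(1). The roots themselves    *)
(* come from Hensel's lemma after v = 1 + x y (resp. v = x y), and the        *)
(* expression in the other two roots follows by Vieta.                        *)

Require Import Defs.
From mathcomp Require Import all_boot all_order all_algebra.
From mathcomp Require Import boolp zify ring.

Set Implicit Arguments.
Unset Strict Implicit.
Unset Printing Implicit Defensive.

Import Order.TTheory GRing.Theory Num.Theory.

(** * Avoidance and sortability *)

(** Avoidance, acceptance by [run] and sortability form a cycle of implications: [avoids_run],
    [run_sortable_from], [popstack_avoids]. Hence the sequences to count correspond to the entries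
    of the list [states n].

    The future of a state depends on its flag, on the room [n - m] above the maximum and, while the
    flag is off, on the gap [m - s], the number of letters that turn the flag on. The gap enters the
    recurrences linearly, so weighting each state by [V] to the power of its room gives a closed
    linear system, solved in [kernel_equation]. There [V] is the inverse of a root of the kernel, so
    only the roots [v1], [v2] of constant term 1 can be substituted; [total_gf_eq] combines the two
    equations. Vieta's formulas for all four roots ([vieta4]) simplify the result to [invseq_gf_eq]
    and carry it over to the roots [w1], [w2] of constant term 0 in [invseq_gf_roots0]. *)

Lemma subseq3P (w : seq nat) a b c :
  reflect (exists i j k, [/\ i < j, j < k, k < size w &
             [/\ a = nth 0 w i, b = nth 0 w j & c = nth 0 w k]])
    (subseq [:: a; b; c] w).
Proof.
apply: (iffP idP) => [/subseqP[m _ E]|[i [j [k [ij jk kw [-> -> ->]]]]]].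
  have: sorted ltn (mask m (iota 0 (size w))).
    by apply: sorted_mask (iota_ltn_sorted _ _); apply: ltn_trans.
  have: {subset mask m (iota 0 (size w)) <= iota 0 (size w)}.
    by move=> x; apply: mem_mask.
  move: E; rewrite -{1}(mkseq_nth 0 w) /mkseq -map_mask.
  case: (mask _ _) => [|i [|j [|k [|l s]]]] //= [-> -> ->] sub /and3P[ij jk _].
  exists i, j, k; split=> //.
  by have := sub k; rewrite !inE eqxx !orbT mem_iota => /(_ isT).
have nthk (x : nat) (s : seq nat) :
    x < size s -> s = take x s ++ nth 0 s x :: drop x.+1 s.
  by move=> h; rewrite -drop_nth // cat_take_drop.
rewrite [X in subseq _ X](nthk i) ?(ltn_trans ij (ltn_trans jk kw)) //.
rewrite -[X in subseq X](cat0s) cat_subseq ?sub0seq //= eqxx.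
set u := drop _ _; have nu l : i < l -> nth 0 w l = nth 0 u (l - i.+1).
  by move=> il; rewrite /u nth_drop subnKC.
have su : size u = size w - i.+1 by rewrite size_drop.
rewrite (nu j) ?(nu k) ?(ltn_trans ij jk) //.
rewrite [X in subseq _ X](nthk (j - i.+1)); last by rewrite su; lia.
rewrite -[X in subseq X](cat0s) cat_subseq ?sub0seq //= eqxx sub1seq.
rewrite (_ : nth 0 u _ = nth 0 (drop (j - i.+1).+1 u) (k - j.+1)).
  by rewrite mem_nth // size_drop su; lia.
by rewrite nth_drop; congr (nth 0 u); lia.
Qed.

Lemma contains3P (w : seq nat) p q r :
  reflect (exists a b c, subseq [:: a; b; c] w /\
      [/\ (a < b) = (p < q), (b < a) = (q < p), (a < c) = (p < r),
          (c < a) = (r < p) & (b < c) = (q < r) /\ (c < b) = (r < q)])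
    (contains w [:: p; q; r]).
Proof.
apply: (iffP existsP) => [[f /forallP H]|[a [b [c [/subseq3P[i [j [k]]]]]]]].
  have mono (x y : 'I_3) : x < y -> f x < f y.
    by move=> xy; case/and3P: (forallP (H x) y) => /implyP/(_ xy).
  have cmp (x y : 'I_3) : (nth 0 w (f x) < nth 0 w (f y))
      = (nth 0 [:: p; q; r] x < nth 0 [:: p; q; r] y).
    by case/and3P: (forallP (H x) y) => _ /eqP.
  pose o0 : 'I_3 := ord0; pose o1 : 'I_3 := inord 1; pose o2 : 'I_3 := inord 2.
  have e1 : o1 = 1 :> nat by rewrite inordK.
  have e2 : o2 = 2 :> nat by rewrite inordK.
  exists (nth 0 w (f o0)), (nth 0 w (f o1)), (nth 0 w (f o2)); split.
    apply/subseq3P; exists (f o0), (f o1), (f o2).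
    by split=> //; apply: mono; rewrite ?e1 ?e2.
  by rewrite !cmp e1 e2.
move=> [ij jk kw [ea eb ec]] [h1 h2 h3 h4 [h5 h6]].
have iw : i < size w by lia.
have jw : j < size w by lia.
exists [ffun l : 'I_3 => tnth [tuple Ordinal iw; Ordinal jw; Ordinal kw] l].
apply/forallP=> x; apply/forallP=> y; rewrite !ffunE.
case: x => [[|[|[|//]]] lx]; case: y => [[|[|[|//]]] ly];
  rewrite !(tnth_nth (Ordinal iw)) /= -?ea -?eb -?ec ?ltnn ?eqxx //=; lia.
Qed.

Definition avoids (w : seq nat) : bool := all (fun p => ~~ contains w p) pats.

Lemma avoidsP (w : seq nat) :
  reflect (forall a b c, subseq [:: a; b; c] w ->
             [/\ ~ (c < a < b), ~ (b < c < a) & ~ (c < b < a)])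
    (avoids w).
Proof.
rewrite /avoids /=; apply: (iffP and4P) => [[h1 h2 h3 _] a b c s|H].
  split=> /andP[l1 l2].
  - by case/contains3P: h1; exists a, b, c; split=> //; split; lia.
  - by case/contains3P: h2; exists a, b, c; split=> //; split; lia.
  - by case/contains3P: h3; exists a, b, c; split=> //; split; lia.
by split=> //; apply/contains3P=> -[a [b [c [/H[? ? ?] [? ? ? ? [? ?]]]]]]; lia.
Qed.

(* [(t, m, s)]: [m] is the largest letter read so far. If [t], some letter   *)
(* below [m] follows an [m], and all such letters equal [s]; otherwise a      *)
(* letter [c < m] may come next iff [s <= c], where [s] is the second largest *)
(* value read, or 0.                                                          *)
Definition state : Type := bool * nat * nat.
Definition smax (st : state) : nat := st.1.2.

Definition step (st : state) (c : nat) : option state :=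
  let: (t, m, s) := st in
  if m < c then Some (false, c, m)
  else if c == m then Some st
  else if t then if c == s then Some st else None
  else if c < s then None else Some (true, m, c).

Definition run (w : seq nat) : option state :=
  foldl (fun o c => obind (step^~ c) o) (Some (false, 0, 0)) w.

Lemma run_rcons w c : run (rcons w c) = obind (step^~ c) (run w).
Proof. by rewrite /run foldl_rcons. Qed.

(** These are the witnesses with which a rejected letter completes a forbidden pattern. The
    alternatives [= 0] allow for the initial values, which need not have been read; they are
    harmless because no letter lies below 0. *)
Definition state_inv (w : seq nat) (st : state) : Prop :=
  let: (t, m, s) := st in
  if t then s < m /\ subseq [:: m; s] w
  else [/\ m = 0 \/ m \in w, s = 0 \/ s \in w & s = 0 \/ s < m].

Lemma subseq2_rcons (w : seq nat) a c : a \in w -> subseq [:: a; c] (rcons w c).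
Proof. by move=> aw; rewrite -cats1 -cat1s cat_subseq // sub1seq ?inE. Qed.

Lemma subseq3_rcons (w : seq nat) a b c :
  subseq [:: a; b] w -> subseq [:: a; b; c] (rcons w c).
Proof.
move=> aw; rewrite -cats1 -[[:: a; b; c]]cat1s -[[:: b; c]]cat1s catA.
by rewrite cat_subseq // sub1seq ?inE.
Qed.

Lemma mem2_subseq (w : seq nat) a b : a \in w -> b \in w -> a != b ->
  subseq [:: a; b] w \/ subseq [:: b; a] w.
Proof.
elim: w => //= c w IH; rewrite !inE => /orP[/eqP->|aw] /orP[/eqP->|bw] ab.
- by rewrite eqxx in ab.
- by left; rewrite eqxx sub1seq.
- by right; rewrite eqxx sub1seq.
case: (IH aw bw ab) => h; [left|right]; case: eqP => // _;
  exact: subseq_trans (subseq_cons _ _) h.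
Qed.

Lemma avoids_prefix u w : avoids (u ++ w) -> avoids u.
Proof.
move=> /avoidsP H; apply/avoidsP=> a b c s.
by apply: H; apply: subseq_trans s (prefix_subseq _ _).
Qed.

Lemma avoids_run w : avoids w -> exists2 st, run w = Some st & state_inv w st.
Proof.
elim/last_ind: w => [|w c IH] A; first by exists (false, 0, 0) => //; split; left.
have [|[[t m] s] rw inv] := IH; first by move: A; rewrite -cats1 => /avoids_prefix.
rewrite run_rcons rw {rw} /=; move/avoidsP: A => A.
case: t inv => /= [[sm msw]|[mw sw ms]].
  case: ltnP => [mc|cm].
    exists (false, c, m) => //; split; rewrite ?mem_rcons ?inE ?eqxx; try by right.
    by right; rewrite (mem_subseq msw) ?orbT // inE eqxx.
  have sub u : subseq u w -> subseq u (rcons w c).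
    by move=> h; apply: subseq_trans h (subseq_rcons _ _).
  case: eqP => [_|/eqP ncm]; first by exists (true, m, s) => //; split=> //; apply: sub.
  case: eqP => [_|/eqP ncs]; first by exists (true, m, s) => //; split=> //; apply: sub.
  (* Here [c < m] and [c != s], so [m], [s], [c] form 201 or 210. *)
  by case: (A _ _ _ (subseq3_rcons c msw)) => *; lia.
have memr x : x \in w -> x \in rcons w c by rewrite mem_rcons inE => ->; rewrite orbT.
case: ltnP => [mc|cm].
  exists (false, c, m) => //; split; rewrite ?mem_rcons ?inE ?eqxx; try by right.
  by case: mw => [|->]; [left|right; rewrite orbT].
case: eqP => [_|/eqP ncm].
  by exists (false, m, s) => //; split=> //;
    [case: mw|case: sw]; auto.
have {mw}mw : m \in w by case: mw ncm cm => // -> ; lia.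
case: ltnP => cs.
  have {sw}sw : s \in w by case: sw cs => // ->.
  (* Since [c < s < m], either order of [s] and [m] in [w] completes a pattern: 120 or 210. *)
  have /(mem2_subseq mw sw) : m != s by lia.
  by case=> /(subseq3_rcons c)/A[*]; lia.
exists (true, m, c) => //; split; first by lia.
exact: subseq2_rcons.
Qed.

Lemma push_below_nseq (i j : nat) m s : s != m ->
  push_below m (nseq i.+1 s ++ nseq j m) = nseq i.+1 s ++ nseq j.+1 m.
Proof.
move=> sm; rewrite /push_below.
have -> : find (fun y => y != head m (nseq i.+1 s ++ nseq j m)) (nseq i.+1 s ++ nseq j m)
    = i.+1.
  rewrite find_cat has_nseq /= eqxx /= size_nseq.
  by case: j => [|j] /=; rewrite ?addn0 // eq_sym sm addn0.
by rewrite take_size_cat ?drop_size_cat ?size_nseq.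
Qed.

Lemma fits_sub (a b : nat) st : {subset st <= [:: a; b]} -> fits st.
Proof.
move=> h; apply: (@uniq_leq_size _ _ [:: a; b]); first exact: undup_uniq.
by move=> x; rewrite mem_undup => /h.
Qed.

(** From top to bottom the stack is a block of [s] above a block of [m], and the output is bounded
    by [s]. A pop at any moment therefore keeps the output sorted. *)
Definition stack_inv (st : state) (stk out : seq nat) : Prop :=
  let: (t, m, s) := st in
  [/\ s <= m, sorted leq out, {in out, forall x, x <= s} &
    if t then s < m /\ exists i j, stk = nseq i.+1 s ++ nseq j m
    else exists j, stk = nseq j m].

Lemma stack_inv_pop st stk out : stack_inv st stk out ->
  sorted leq (out ++ stk) /\ {in out ++ stk, forall x, x <= smax st}.
Proof.
case: st => [[t m] s] [sm so os hs]; rewrite /smax /=.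
have srt (b : seq nat) :
    {in b, forall x, s <= x} -> sorted leq b -> sorted leq (out ++ b).
  move=> h sb.
  rewrite sorted_pairwise ?pairwise_cat -?sorted_pairwise; try exact: leq_trans.
  by rewrite so sb !andbT; apply/allrelP=> x y /os h1 /h; apply: leq_trans.
have snseq i x : sorted leq (nseq i x).
  by case: i => //= i; elim: i => //= i ->; rewrite leqnn.
case: t hs => [[lt [i [j ->]]]|[j ->]].
  split.
    apply: srt => [x|].
      by rewrite mem_cat !mem_nseq => /orP[]/andP[_ /eqP->].
    rewrite sorted_pairwise ?pairwise_cat -?sorted_pairwise; try exact: leq_trans.
    rewrite !snseq !andbT; apply/allrelP=> x y.
    by rewrite !mem_nseq => /andP[_ /eqP->] /andP[_ /eqP->].
  move=> x; rewrite !mem_cat !mem_nseq => /or3P[/os|/andP[_ /eqP->]|/andP[_ /eqP->]] //.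
  by move=> h; apply: leq_trans h sm.
split; first by apply: srt => // x; rewrite mem_nseq => /andP[_ /eqP->].
move=> x; rewrite mem_cat mem_nseq => /orP[/os h|/andP[_ /eqP->]] //.
exact: leq_trans h sm.
Qed.

(** The strategy: a new maximum is pushed after a pop, a smaller letter goes on top, and a repeated
    [m] slides below the block of [s] if there is one. Acceptance by [step] is what preserves
    [stack_inv]. *)
Lemma run_sortable_from w st stk out :
  stack_inv st stk out ->
  foldl (fun o c => obind (step^~ c) o) (Some st) w ->
  exists2 res, popstack w stk out res & sorted leq res.
Proof.
elim: w st stk out => [|c w IH] st stk out inv.
  case/stack_inv_pop: (inv) => so _ _; exists (out ++ stk) => //.
  exact/popstack_pop/popstack_done.
have none : foldl (fun o c => obind (step^~ c) o) None w = None by elim: (w).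
move=> /=; case E : (step st c) => [st'|]; last by rewrite /= none.
move=> acc; case: (stack_inv_pop inv) => so ob.
case: st E inv ob => [[t m] s] E [sm sout os hs]; rewrite /smax /= => ob.
move: E; rewrite /step; case: ltnP => [mc [e]|cm].
  have [] := IH st' [:: c] (out ++ stk) _ acc.
    by rewrite -e; split=> //; [apply: ltnW|exists 1].
  by move=> res p sr; exists res => //; apply/popstack_pop/popstack_top.
case: eqP => [-> [e]|/eqP ncm].
  case: t e hs => e [].
    move=> lt [i [j stkE]].
    have [|res p sr] := IH st' (push_below m stk) out _ acc.
      rewrite stkE push_below_nseq -?e; last by lia.
      by split=> //; split=> //; exists i, j.+1.
    exists res => //; apply: popstack_below p.
    apply: (@fits_sub m s) => x.
    rewrite stkE inE mem_cat !mem_nseq !inE.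
  by move=> /or3P[->|/andP[_ ->]|/andP[_ ->]]; rewrite ?orbT.
  move=> j stkE.
  have [|res p sr] := IH st' (m :: stk) out _ acc.
    by rewrite stkE -e; split=> //; exists j.+1.
  exists res => //; apply: popstack_top p.
  apply: (@fits_sub m m) => x.
  by rewrite stkE !inE !mem_nseq orbb => /orP[//|/andP[]].
case: t hs => [[lt [i [j stkE]]]|[j stkE]].
  case: eqP => // -> [e].
  have [|res p sr] := IH st' (s :: stk) out _ acc.
    by rewrite stkE -e; split=> //; split=> //; exists i.+1, j.
  exists res => //; apply: popstack_top p.
  apply: (@fits_sub m s) => x.
  rewrite stkE inE mem_cat !mem_nseq !inE.
  by move=> /or3P[->|/andP[_ ->]|/andP[_ ->]]; rewrite ?orbT.
case: ltnP => // sc [e].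
have [|res p sr] := IH st' (c :: stk) out _ acc.
  rewrite stkE -e; split=> // [x /os h|]; first exact: leq_trans h sc.
  by split; [lia|exists 0, j].
exists res => //; apply: popstack_top p.
apply: (@fits_sub m c) => x.
by rewrite stkE !inE !mem_nseq => /orP[->|/andP[_ ->]]; rewrite ?orbT.
Qed.

Lemma push_below_perm x st : perm_eq (push_below x st) (x :: st).
Proof.
rewrite /push_below; set k := find _ _.
by rewrite -(cat1s x (drop k st)) perm_catCA /= cat_take_drop.
Qed.

Lemma popstack_output inp st out res : popstack inp st out res ->
  exists2 r, res = out ++ r & perm_eq r (st ++ inp).
Proof.
elim=> {inp st out res} [out|inp st out res _ [r -> pr]|x inp st out res _ _ [r -> pr]
  |x inp st out res _ _ [r -> pr]].
- by exists [::]; rewrite ?cats0.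
- by exists (st ++ r); rewrite ?catA // perm_cat2l.
- by exists r => //; apply: perm_trans pr _; rewrite perm_sym -(cat1s x inp) perm_catCA.
exists r => //; apply: perm_trans pr _; apply: (@perm_trans _ ((x :: st) ++ inp)).
  by rewrite perm_cat2r push_below_perm.
by rewrite perm_sym -(cat1s x inp) perm_catCA.
Qed.

Lemma subseq3_cat (u w : seq nat) a b c : subseq [:: a; b; c] (u ++ w) ->
  [\/ subseq [:: a; b; c] u,
      [/\ a \in u, b \in u & c \in w],
      [/\ a \in u, b \in w & c \in w]
    | subseq [:: a; b; c] w].
Proof.
case/subseq3P=> [i [j [k [ij jk]]]]; rewrite size_cat => kw [].
rewrite !nth_cat; case: (ltnP k) => ku.
  rewrite (ltn_trans ij) ?(ltn_trans jk) // => ea eb ec; apply: Or41.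
  by apply/subseq3P; exists i, j, k.
have kw' : k - size u < size w by lia.
case: (ltnP j) => ju.
  rewrite (ltn_trans ij) // => -> -> ->; apply: Or42.
  by split; apply: mem_nth; rewrite ?(ltn_trans ij).
have jw : j - size u < size w by lia.
case: (ltnP i) => iu -> -> ->.
  by apply: Or43; split; apply: mem_nth.
by apply: Or44; apply/subseq3P; exists (i - size u), (j - size u), (k - size u);
  split=> //; lia.
Qed.

(* Between two pops the stack holds at most two values, and sortedness of the *)
(* output separates the blocks popped together; a forbidden pattern has three *)
(* values and straddles no such separation.                                   *)
Lemma popstack_avoids inp st out res : popstack inp st out res ->
  sorted leq res -> fits st ->
  forall h, perm_eq h st -> avoids (h ++ inp).
Proof.
elim=> {inp st out res}
  [out|inp st out res p IH|x inp st out res fx p IH|x inp st out res fx p IH].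
- by move=> _ _ h /perm_nilP ->; apply/avoidsP.
- move=> sr fst h hs; have /avoidsP A := IH sr isT [::] isT.
  have sep : {in h & inp, forall x y, x <= y}.
    move=> x y xh yi; case: (popstack_output p) sr => r -> pr.
    rewrite sorted_pairwise; last exact: leq_trans.
    rewrite pairwise_cat => /andP[/allrelP] + _; apply.
      by rewrite mem_cat -(perm_mem hs) xh orbT.
    by rewrite (perm_mem pr).
  apply/avoidsP=> a b c /subseq3_cat[s3|[ah bh ci]|[ah bi ci]|/A //].
  + have two : ~~ uniq [:: a; b; c].
      apply/negP=> u3; have : size [:: a; b; c] <= size (undup st).
        apply: uniq_leq_size u3 _ => y /(mem_subseq s3).
        by rewrite mem_undup (perm_mem hs).
      by move/leq_trans => /(_ 2 fst).
    by move: two; rewrite /= !inE => two; split; lia.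
  + by have := sep _ _ ah ci; have := sep _ _ bh ci; split; lia.
  + by have := sep _ _ ah bi; have := sep _ _ ah ci; split; lia.
(* [h] lists the stack letters in order of arrival. It is tied to the stack only up to permutation,
   so both kinds of push append the new letter to [h]. *)
- move=> sr _ h hs; rewrite -cat_rcons; apply: IH => //.
  by rewrite perm_rcons perm_cons.
move=> sr _ h hs; rewrite -cat_rcons.
have pb := push_below_perm x st.
apply: IH => //; first by rewrite /fits (perm_size (perm_undup (perm_mem pb))).
by apply: perm_trans (_ : perm_eq (x :: st) _); rewrite ?perm_rcons ?perm_cons // perm_sym.
Qed.

Lemma run_sortable w : run w -> sortable w.
Proof. by apply: run_sortable_from; split=> //; exists 0. Qed.

Lemma sortable_avoids w : sortable w -> avoids w.
Proof. by case=> res p sr; apply: (popstack_avoids p sr _ (h := [::])). Qed.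

Lemma avoids_sortable w : avoids w <-> sortable w.
Proof.
split; last exact: sortable_avoids.
by case/avoids_run => st h _; apply: run_sortable; rewrite h.
Qed.

Lemma avoidsE w : avoids w = isSome (run w).
Proof.
apply/idP/idP => [/avoids_run[st -> _] //|/run_sortable/sortable_avoids //].
Qed.

(** * The generating tree *)

Fixpoint inv_words (n : nat) : seq (seq nat) :=
  if n is n'.+1 then [seq rcons w c | w <- inv_words n', c <- iota 0 n'.+1]
  else [:: [::]].

Lemma inv_words_uniq n : uniq (inv_words n).
Proof.
elim: n => [//|n IH]; apply: allpairs_uniq => //; first exact: iota_uniq.
by move=> [u c] [w d] _ _ /= /rcons_inj [-> ->].
Qed.

Lemma mem_inv_words n w :
  (w \in inv_words n) = (size w == n) && all (fun i => nth 0 w i <= i) (iota 0 n).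
Proof.
elim: n w => [|n IH] w; first by rewrite inE -size_eq0 andbT.
apply/allpairsP/andP => [[[u c] [uw cn ->]]|[/eqP sw /allP H]].
  move: cn uw; rewrite mem_iota IH ltnS [_.1]/= [_.2]/= => cn /andP[/eqP su /allP H].
  rewrite size_rcons su; split=> //; apply/allP=> i; rewrite mem_iota add0n => lin.
  rewrite nth_rcons su; case: (ltnP i n) => lt; first by apply: H; rewrite mem_iota.
  by rewrite (_ : i == n) //; lia.
elim/last_ind: w sw H => [|w c _] //; rewrite size_rcons => -[sw] H.
exists (w, c); split=> //.
  rewrite IH sw eqxx; apply/allP=> i; rewrite mem_iota => /= lin.
  have := H i; rewrite nth_rcons sw lin; apply.
  by rewrite mem_iota; lia.
have := H n; rewrite [(_, _).2]/= nth_rcons sw ltnn eqxx !mem_iota !add0n !ltnS /= leqnn.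
by apply.
Qed.

Lemma word_inj n : injective (@word n).
Proof. by move=> e f /(inj_map val_inj)/val_inj. Qed.

Lemma nth_word n (e : n.-tuple 'I_n) (i : 'I_n) : nth 0 (word e) i = tnth e i.
Proof. by rewrite (nth_map i) ?size_tuple // -tnth_nth. Qed.

Lemma word_inv_words n (e : n.-tuple 'I_n) :
  (word e \in inv_words n) = (e \in invseq n).
Proof.
rewrite mem_inv_words size_map size_tuple eqxx inE.
apply/allP/forallP => [H i|H i].
  by rewrite -nth_word; apply: H; rewrite mem_iota /=.
by rewrite mem_iota /= => lin; have := H (Ordinal lin); rewrite -nth_word.
Qed.

Lemma inv_words_word n w : w \in inv_words n -> exists e : n.-tuple 'I_n, w = word e.
Proof.
rewrite mem_inv_words => /andP[/eqP sw /allP H].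
have lt (i : 'I_n) : nth 0 w i < n.
  by apply: leq_ltn_trans (H _ _) (ltn_ord i); rewrite mem_iota /=.
exists [tuple Ordinal (lt i) | i < n].
apply: (@eq_from_nth _ 0) => [|i]; first by rewrite size_map size_tuple.
by rewrite sw => lin; rewrite (nth_word _ (Ordinal lin)) tnth_mktuple.
Qed.

(** Repetitions are kept: there is one entry per accepted inversion sequence, so the size of the
    list is the count. It is also what makes the first coefficients computable. *)
Fixpoint states (n : nat) : seq state :=
  if n is n'.+1 then flatten [seq pmap (step st) (iota 0 n) | st <- states n']
  else [:: (false, 0, 0)].

Lemma statesE n : states n = pmap run (inv_words n).
Proof.
elim: n => [//|n IH].
change (flatten [seq pmap (step st) (iota 0 n.+1) | st <- states n]
  = pmap run [seq rcons w c | w <- inv_words n, c <- iota 0 n.+1]).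
move: (iota 0 n.+1) => l; rewrite IH.
elim: (inv_words n) => //= w ws IHw; rewrite pmap_cat -IHw.
have -> : pmap run [seq rcons w c | c <- l] = pmap (fun c => obind (step^~ c) (run w)) l.
  by elim: l {IHw} => //= c l ->; rewrite run_rcons.
case: (run w) => //=; rewrite (_ : pmap _ l = [::]) //.
by elim: l {IHw}.
Qed.

Lemma card_invseq_avoid n : #|invseq_avoid n pats| = size (states n).
Proof.
rewrite statesE size_pmap -(eq_count avoidsE) -size_filter.
rewrite cardE -(size_map (@word n)); apply: perm_size; apply: uniq_perm.
- by rewrite map_inj_uniq ?enum_uniq //; apply: word_inj.
- by rewrite filter_uniq // inv_words_uniq.
move=> w; rewrite mem_filter; apply/mapP/andP => [[e]|[aw ww]].
  by rewrite mem_enum inE => /andP[ei ae] ->; rewrite word_inv_words.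
have [e wE] := inv_words_word ww; exists e => //.
by rewrite mem_enum inE -word_inv_words -wE ww.
Qed.

Lemma states_bounds n st : st \in states n ->
  let: (t, m, s) := st in [&& s <= m, m <= n & t ==> (s < m)].
Proof.
elim: n st => [|n IH] st; first by rewrite inE => /eqP->.
case/flattenP=> l /mapP[[[t m] s] /IH/and3P[sm mn ts] ->].
rewrite mem_pmap => /mapP[c]; rewrite mem_iota /= add0n ltnS => cn.
case: ltnP => mc; first by case=> ->; lia.
case: eqP => cm; first by case=> ->; lia.
case: t ts => /= ts; first by case: eqP => // cs [->]; lia.
by case: ltnP => // cs [->]; lia.
Qed.

Local Open Scope ring_scope.

(** * Recurrences for the states weighted by their room *)

Section Statistics.
Variables (R : comNzRingType) (V : R).

Lemma sum_states_S n (phi : state -> R) :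
  \sum_(st <- states n.+1) phi st
  = \sum_(st <- states n) \sum_(0 <= c < n.+1) oapp phi 0 (step st c).
Proof.
rewrite big_flatten big_map; apply: eq_bigr => st _.
rewrite /index_iota subn0; elim: (iota _ _) => [|c l IH]; first by rewrite !big_nil.
by rewrite big_cons -IH /=; case: (step st c) => [st'|] /=; rewrite ?big_cons ?add0r.
Qed.

Lemma sum_step_asc n m s (phi : state -> R) : (s <= m <= n)%N ->
  \sum_(0 <= c < n.+1) oapp phi 0 (step (false, m, s) c)
  = \sum_(s <= c < m) phi (true, m, c) + phi (false, m, s)
    + \sum_(m.+1 <= c < n.+1) phi (false, c, m).
Proof.
case/andP=> sm mn; rewrite (big_cat_nat (n := m)) //=; last exact: leqW.
rewrite (big_cat_nat (n := s)) //= (@big_ltn _ _ _ m n.+1) //=.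
rewrite ltnn eqxx /= big_nat_cond big1 ?add0r => [|c]; last first.
  by case/andP=> /andP[_ cs] _;
    rewrite ltnNge ltnW ?(leq_trans cs) //= ltn_eqF ?(leq_trans cs) // cs.
rewrite addrA; congr (_ + _ + _); apply: eq_big_nat => c /andP[h1 h2].
  by rewrite ltnNge ltnW //= ltn_eqF // ltnNge h1.
by rewrite h1.
Qed.

(** Only [m] and [s] are accepted among the letters up to [m], and both leave the state unchanged;
    hence the factor 2. *)
Lemma sum_step_desc n m s (phi : state -> R) : (s < m <= n)%N ->
  \sum_(0 <= c < n.+1) oapp phi 0 (step (true, m, s) c)
  = phi (true, m, s) *+ 2 + \sum_(m.+1 <= c < n.+1) phi (false, c, m).
Proof.
case/andP=> sm mn; rewrite (big_cat_nat (n := m)) //=; last exact: leqW.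
rewrite (@big_ltn _ _ _ m n.+1) //= ltnn eqxx /=.
rewrite (bigD1_seq s) ?mem_index_iota ?iota_uniq //=.
rewrite (ltnNge m s) ltnW //= ltn_eqF // eqxx /=.
rewrite big_nat_cond big1 ?addr0 => [|c]; last first.
  by case/andP=> /andP[_ cm] cs; rewrite ltnNge ltnW //= ltn_eqF // (negPf cs).
rewrite addrA; congr (_ + _).
by apply: eq_big_nat => c /andP[h1 h2]; rewrite h1.
Qed.

(* The contributions of the new maxima [m < c <= n] below a state with        *)
(* [k = n - m], unweighted and weighted by the gap [c - m].                   *)
Definition geo k : R := \sum_(i < k) V ^+ (k - i).
Definition wgeo k : R := \sum_(i < k) i.+1%:R * V ^+ (k - i).

(** Kept free of division: [V] will be a power series of constant term 1, for which [V - 1] is not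
    invertible. *)
Lemma geoE k : (V - 1) * geo k = V * (V ^+ k - 1).
Proof.
rewrite /geo; elim: k => [|k IH]; first by rewrite big_ord0; ring.
by rewrite big_ord_recl subn0 mulrDr IH exprS; ring.
Qed.

Lemma wgeoE k : (V - 1) ^+ 2 * wgeo k = V * (V * (V ^+ k - 1) - (V - 1) * k%:R).
Proof.
elim: k => [|k IH]; first by rewrite /wgeo big_ord0; ring.
have -> : wgeo k.+1 = V ^+ k.+1 + (wgeo k + geo k).
  rewrite /wgeo /geo big_ord_recl subn0 mul1r -big_split; congr (_ + _).
  by apply: eq_bigr => i _; rewrite /= subSS -natr1 mulrDl mul1r.
rewrite !mulrDr IH expr2 -(mulrA _ _ (geo k)) geoE -natr1 exprS; ring.
Qed.

Lemma sum_geo n m (mn : (m <= n)%N) :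
  \sum_(m.+1 <= c < n.+1) V ^+ (n.+1 - c) = geo (n - m).
Proof.
rewrite /geo -(big_mkord predT (fun i => V ^+ (n - m - i))) -{1}[m.+1]add0n big_addn.
by rewrite subSS; apply: eq_big_nat => i /andP[_ h]; congr (_ ^+ _); lia.
Qed.

Lemma sum_wgeo n m (mn : (m <= n)%N) :
  \sum_(m.+1 <= c < n.+1) (c - m)%:R * V ^+ (n.+1 - c) = wgeo (n - m).
Proof.
rewrite /wgeo -(big_mkord predT (fun i => i.+1%:R * V ^+ (n - m - i))).
rewrite -{1}[m.+1]add0n big_addn.
rewrite subSS; apply: eq_big_nat => i /andP[_ h]; congr (_%:R * _ ^+ _); lia.
Qed.

(** With f(V) = [asc_gf n + desc_gf n], the number of states is f(1) and [room n] is f'(1). The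
    weight in [gap_gf] counts the letters [s <= c < m] that turn the flag on. *)
Definition asc_gf n : R :=
  \sum_(st <- states n) (if st.1.1 then 0 else V ^+ (n - smax st)).
Definition desc_gf n : R :=
  \sum_(st <- states n) (if st.1.1 then V ^+ (n - smax st) else 0).
Definition gap_gf n : R :=
  \sum_(st <- states n)
    (if st.1.1 then 0 else (smax st - st.2)%:R * V ^+ (n - smax st)).
Definition room n : R := \sum_(st <- states n) (n - smax st)%:R.

(** The new maxima contribute V times the divided difference of f between V and 1. *)
Lemma sum_geo_states n : (V - 1) * \sum_(st <- states n) geo (n - smax st)
  = V * (asc_gf n + desc_gf n - (size (states n))%:R).
Proof.
rewrite /asc_gf /desc_gf; elim: (states n) => [|st l IH].
  by rewrite !big_nil /=; ring.
rewrite !big_cons mulrDr IH geoE /= -natr1; case: st.1.1; ring.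
Qed.

(** The gap weight of a new maximum leads to a second-order difference of f at 1, and this is where
    f'(1) enters. *)
Lemma sum_wgeo_states n : (V - 1) ^+ 2 * \sum_(st <- states n) wgeo (n - smax st)
  = V * (V * (asc_gf n + desc_gf n - (size (states n))%:R) - (V - 1) * room n).
Proof.
rewrite /asc_gf /desc_gf /room; elim: (states n) => [|st l IH].
  by rewrite !big_nil /=; ring.
rewrite !big_cons mulrDr IH wgeoE /= -natr1; case: st.1.1; ring.
Qed.

Lemma asc_gfS n :
  asc_gf n.+1 = V * asc_gf n + \sum_(st <- states n) geo (n - smax st).
Proof.
rewrite /asc_gf sum_states_S mulr_sumr -big_split; apply: eq_big_seq.
move=> [[t m] s] /states_bounds/and3P[sm mn]; rewrite /smax; case: t => /= [lsm|_].
  by rewrite sum_step_desc ?lsm //= mul0rn add0r mulr0 add0r sum_geo.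
rewrite sum_step_asc ?sm //= big1 // add0r sum_geo //.
by rewrite subSn // exprS.
Qed.

Lemma gap_gfS n :
  gap_gf n.+1 = V * gap_gf n + \sum_(st <- states n) wgeo (n - smax st).
Proof.
rewrite /gap_gf sum_states_S mulr_sumr -big_split; apply: eq_big_seq.
move=> [[t m] s] /states_bounds/and3P[sm mn]; rewrite /smax; case: t => /= [lsm|_].
  by rewrite sum_step_desc ?lsm //= mul0rn add0r mulr0 add0r sum_wgeo.
rewrite sum_step_asc ?sm //= big1 // add0r sum_wgeo //.
by rewrite subSn // exprS mulrCA.
Qed.

Lemma desc_gfS n : desc_gf n.+1 = V * desc_gf n *+ 2 + V * gap_gf n.
Proof.
rewrite /desc_gf /gap_gf sum_states_S !mulr_sumr -sumrMnl -big_split; apply: eq_big_seq.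
move=> [[t m] s] /states_bounds/and3P[sm mn]; rewrite /smax; case: t => /= [lsm|_].
  by rewrite sum_step_desc ?lsm //= big1 // mulr0 !addr0 subSn // exprS.
rewrite sum_step_asc ?sm //= [X in _ + X]big1 // !addr0 mulr0 mul0rn add0r.
by rewrite sumr_const_nat subSn // exprS mulrCA mulr_natl.
Qed.

End Statistics.

(** * Formal power series *)

Section Series.
Variable R : comNzRingType.
Implicit Types (f g : fps R) (P : nat -> fps R).
Local Notation x := (fpsX R).

Lemma fcoefD f g n : fcoef (f + g) n = fcoef f n + fcoef g n. Proof. by []. Qed.
Lemma fcoefN f n : fcoef (- f) n = - fcoef f n. Proof. by []. Qed.
Lemma fcoef0 n : fcoef (0 : fps R) n = 0. Proof. by []. Qed.
Lemma fcoef1 n : fcoef (1 : fps R) n = (n == 0%N)%:R. Proof. by []. Qed.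
Lemma fcoefX n : fcoef x n = (n == 1%N)%:R. Proof. by []. Qed.

Lemma fcoefM f g n :
  fcoef (f * g) n = \sum_(i < n.+1) fcoef f i * fcoef g (n - i)%N.
Proof. by []. Qed.

Lemma fcoef_nat k n : fcoef (k%:R : fps R) n = if n is 0%N then k%:R else 0.
Proof.
elim: k => [|k IH]; first by case: n.
by rewrite -natr1 fcoefD IH fcoef1; case: n {IH} => [|n]; rewrite ?natr1 ?addr0.
Qed.

Lemma fcoefM0 f g : fcoef (f * g) 0 = fcoef f 0 * fcoef g 0.
Proof. by rewrite fcoefM big_ord_recl big_ord0 addr0. Qed.

Lemma fcoefM1 f g :
  fcoef (f * g) 1 = fcoef f 0 * fcoef g 1 + fcoef f 1 * fcoef g 0.
Proof. by rewrite fcoefM !big_ord_recl big_ord0 addr0. Qed.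

Lemma fcoefXM f n : fcoef (x * f) n = if n is n'.+1 then fcoef f n' else 0.
Proof.
case: n => [|n]; first by rewrite fcoefM0 mul0r.
rewrite fcoefM !big_ord_recl mul0r add0r mul1r subSS subn0 big1 ?addr0 //.
by move=> i _; rewrite fcoefX /= mul0r.
Qed.

(* [\sum_n x^n P_n]; only the first [m.+1] terms contribute in degree [m].    *)
Definition fsum P : fps R :=
  Fps (fun m => \sum_(n < m.+1) fcoef (P n) (m - n)%N).

Lemma fsumS P : fsum P = P 0%N + x * fsum (fun n => P n.+1).
Proof.
apply/fpsP=> m; rewrite fcoefD fcoefXM; case: m => [|m].
  by rewrite /= big_ord_recl big_ord0.
by rewrite /= big_ord_recl subn0.
Qed.

Lemma fcoef_fsum0 P : fcoef (fsum P) 0 = fcoef (P 0%N) 0.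
Proof. by rewrite fsumS fcoefD fcoefXM addr0. Qed.

Lemma fsumD P P' : fsum (fun n => P n + P' n) = fsum P + fsum P'.
Proof. by apply/fpsP=> m; rewrite fcoefD /= -big_split. Qed.

Lemma fsumN P : fsum (fun n => - P n) = - fsum P.
Proof. by apply/fpsP=> m; rewrite fcoefN /= -sumrN. Qed.

(** Induction on the degree through [fsumS], which spares an exchange of nested sums. *)
Lemma fsumMl f P : fsum (fun n => f * P n) = f * fsum P.
Proof.
apply/eqP; rewrite -subr_eq0; apply/eqP/fpsP=> m; elim: m P => [|m IH] P.
  by rewrite fcoefD fcoefN fcoefM0 !fcoef_fsum0 fcoefM0 subrr.
rewrite (fsumS P) (fsumS (fun n => f * P n)) mulrDr [f * (x * _)]mulrCA.
by rewrite opprD addrACA subrr add0r -mulrBr fcoefXM IH.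
Qed.

Lemma fsum_nat (k : nat -> nat) : fsum (fun n => (k n)%:R) = Fps (fun n => (k n)%:R).
Proof.
apply/fpsP=> m; elim: m k => [|m IH] k.
  by rewrite fsumS fcoefD fcoefXM fcoef_nat addr0.
by rewrite fsumS fcoefD fcoefXM IH fcoef_nat add0r.
Qed.

Definition vanish n f : Prop := forall i, (i < n)%N -> fcoef f i = 0.

Lemma vanishM n f g : vanish n f -> vanish n (f * g).
Proof.
move=> vf i lin; rewrite fcoefM big1 // => j _; rewrite vf ?mul0r //.
exact: leq_ltn_trans (leq_ord j) lin.
Qed.

Lemma vanishMS n f g : vanish n f -> fcoef g 0 = 0 -> vanish n.+1 (f * g).
Proof.
move=> vf g0 i; rewrite ltnS => lin; rewrite fcoefM big_ord_recr /= subnn g0 mulr0 addr0.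
by rewrite big1 // => j _; rewrite vf ?mul0r //; apply: leq_trans (ltn_ord j) lin.
Qed.

End Series.

(** * Hensel's lemma and Vieta's formulas *)

Section Hensel.
Variable F : fieldType.
Implicit Types y z : fps F.

Definition fconst (c : F) : fps F := Fps (fun n => if n is 0%N then c else 0).

(* [Q] is the divided difference of [P]; the root is the limit of the         *)
(* iteration [y - P y / u].                                                   *)
Lemma fps_hensel (P : fps F -> fps F) (Q : fps F -> fps F -> fps F) (c u : F) :
  u != 0 ->
  (forall y z, P y - P z = (y - z) * Q y z) ->
  (forall y z, fcoef y 0 = c -> fcoef z 0 = c -> fcoef (Q y z) 0 = u) ->
  (forall y, fcoef y 0 = c -> fcoef (P y) 0 = 0) ->
  exists2 y, fcoef y 0 = c & P y = 0.
Proof.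
move=> u0 PQ Q0 P0; pose next y := y - fconst u^-1 * P y.
pose s n := iter n next (fconst c).
have sS n : s n.+1 = next (s n) by [].
have s0 n : fcoef (s n) 0 = c.
  elim: n => // n IH; rewrite sS /next fcoefD fcoefN fcoefM0 P0 ?mulr0 ?subr0 //.
have vs n : vanish n.+1 (P (s n)).
  elim: n => [|n IH]; first by case=> // _; apply: P0.
  (* The second factor has constant term [1 - u^-1 * u = 0], so each iteration raises the order of
     vanishing by one. *)
  have -> : P (s n.+1) = P (s n) * (1 - fconst u^-1 * Q (s n.+1) (s n)).
    have /(canRL (subrK _)) -> := PQ (s n.+1) (s n).
    by rewrite {1}sS /next; ring.
  apply: vanishMS => //; rewrite fcoefD fcoefN fcoefM0 Q0 //.
  by rewrite [fcoef (fconst _) 0]/= mulVf // subrr.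
have step n m : (n <= m)%N -> fcoef (s m) n = fcoef (s n) n.
  elim: m => [|m IH]; first by rewrite leqn0 => /eqP->.
  rewrite leq_eqVlt => /orP[/eqP-> //|]; rewrite ltnS => nm.
  rewrite -IH // sS /next fcoefD fcoefN mulrC [fcoef (_ * _) _](vanishM _ (vs m)) //.
  by rewrite subr0.
exists (Fps (fun n => fcoef (s n) n)) => //.
set y := Fps _; apply/fpsP=> n.
(* The limit [y] agrees with [s n] up to degree [n], so [P y] inherits the vanishing of [P (s n)] in
   that degree. *)
have -> : P y = P (s n) + (y - s n) * Q y (s n) by rewrite -PQ addrC subrK.
rewrite fcoefD vs // add0r; have /vanishM -> // : vanish n.+1 (y - s n).
by move=> i lin; rewrite fcoefD fcoefN /= (step i) ?subrr.
Qed.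

Lemma fps_hensel_quartic (c0 c1 c2 c3 c4 : fps F) (c : F) :
  let a i := fcoef i 0 in
  a c0 + a c1 * c + a c2 * c ^+ 2 + a c3 * c ^+ 3 + a c4 * c ^+ 4 = 0 ->
  a c1 + a c2 * c *+ 2 + a c3 * c ^+ 2 *+ 3 + a c4 * c ^+ 3 *+ 4 != 0 ->
  exists2 y, fcoef y 0 = c
    & c0 + c1 * y + c2 * y ^+ 2 + c3 * y ^+ 3 + c4 * y ^+ 4 = 0.
Proof.
move=> a root simple; pose P y := c0 + c1 * y + c2 * y ^+ 2 + c3 * y ^+ 3 + c4 * y ^+ 4.
pose Q y z := c1 + c2 * (y + z) + c3 * (y ^+ 2 + y * z + z ^+ 2)
  + c4 * (y ^+ 3 + y ^+ 2 * z + y * z ^+ 2 + z ^+ 3).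
apply: (@fps_hensel P Q c _ simple) => [y z|y z yc zc|y yc]; rewrite /P /Q.
- by ring.
- by rewrite !(expr2, exprS, expr0, fcoefD, fcoefM0, yc, zc, fcoef1) /a; ring.
by rewrite -[RHS]root !(expr2, exprS, expr0, fcoefD, fcoefM0, yc, fcoef1) /a; ring.
Qed.

End Hensel.

(** Iterated divided differences of [q] vanish at distinct roots, because a nonzero difference of
    roots cancels in a domain. The third one gives [s1]; substituting back into [d2], [d1] and [q]
    gives the rest. *)
Lemma vieta4 (R : idomainType) (s1 s2 s3 s4 a b c d : R) :
  let q t := s4 - s3 * t + s2 * t ^+ 2 - s1 * t ^+ 3 + t ^+ 4 in
  q a = 0 -> q b = 0 -> q c = 0 -> q d = 0 ->
  a != b -> a != c -> a != d -> b != c -> b != d -> c != d ->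
  [/\ s1 = a + b + c + d,
      s2 = a * b + (a + b) * (c + d) + c * d,
      s3 = a * b * (c + d) + c * d * (a + b) & s4 = a * b * (c * d)].
Proof.
move=> q qa qb qc qd ab ac ad bc bd cd.
have cancel (u v w : R) : u != v -> (u - v) * w = 0 -> w = 0.
  by rewrite -subr_eq0 => uv /eqP; rewrite mulf_eq0 (negPf uv) => /eqP.
pose d1 u v := - s3 + s2 * (u + v) - s1 * (u ^+ 2 + u * v + v ^+ 2)
  + (u ^+ 3 + u ^+ 2 * v + u * v ^+ 2 + v ^+ 3).
pose d2 u v w := s2 - s1 * (u + v + w)
  + (u ^+ 2 + v ^+ 2 + w ^+ 2 + u * v + u * w + v * w).
have E1 u v : u != v -> q u = 0 -> q v = 0 -> d1 u v = 0.
  move=> uv qu qv; apply: (cancel u v) => //; rewrite -[RHS](subrr (q u)).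
  by rewrite {2}qu -qv /d1 /q; ring.
have E2 u v w : v != w -> d1 u v = 0 -> d1 u w = 0 -> d2 u v w = 0.
  move=> vw dv dw; apply: (cancel v w) => //; rewrite -[RHS](subrr (d1 u v)).
  by rewrite {2}dv -dw /d1 /d2; ring.
have dab := E1 _ _ ab qa qb; have dac := E1 _ _ ac qa qc; have dad := E1 _ _ ad qa qd.
have dabc := E2 _ _ _ bc dab dac; have dabd := E2 _ _ _ bd dab dad.
have S1 : s1 = a + b + c + d.
  apply/eqP; rewrite eq_sym -subr_eq0; apply/eqP; apply: (cancel c d) => //.
  by rewrite -[RHS](subrr (d2 a b c)) {2}dabc -dabd /d2; ring.
have S2 : s2 = a * b + (a + b) * (c + d) + c * d.
  by rewrite -[LHS]subr0 -dabc /d2 S1; ring.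
have S3 : s3 = a * b * (c + d) + c * d * (a + b).
  by rewrite -[LHS]addr0 -dab /d1 S1 S2; ring.
by split=> //; rewrite -[LHS]subr0 -qa /q S1 S2 S3; ring.
Qed.

(** * The kernel method *)

Section KernelMethod.
Variable F : fieldType.
Local Notation x := (fpsX F).

Definition total_gf : fps F := Fps (fun n => (size (states n))%:R).

Lemma invseq_gfE : total_gf = 1 + invseq_gf F.
Proof.
apply/fpsP=> -[|n]; rewrite fcoefD fcoef1 /= ?addr0 ?add0r //.
by rewrite card_invseq_avoid.
Qed.

(** The recurrences, summed over [n], are solved for [a + b]. Its coefficient vanishes at
    [V = 1 / w], which leaves a relation between f(1) and f'(1) summed over [n], here cleared of [V]
    by a factor [w ^+ 3]. *)
Lemma kernel_equation (w V : fps F) : w * V = 1 -> kernel w = 0 ->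
  (w - 2 * x) * (1 - w) ^+ 2 - x * (w - 2 * x) * (1 - w) * total_gf
    - x ^+ 2 * total_gf - x ^+ 2 * (1 - w) * fsum (room (fps F)) = 0.
Proof.
move=> wV Kw; set G := total_gf; set H := fsum _.
pose a := fsum (asc_gf V); pose b := fsum (desc_gf V); pose d := fsum (gap_gf V).
pose S := fsum (fun n => \sum_(st <- states n) geo V (n - smax st)).
pose T := fsum (fun n => \sum_(st <- states n) wgeo V (n - smax st)).
have GE : G = fsum (fun n => (size (states n))%:R) by rewrite fsum_nat.
have aE : a = 1 + x * (V * a + S).
  have <- : fsum (fun n => asc_gf V n.+1) = V * a + S.
    by rewrite -fsumMl -fsumD; congr fsum; apply/funext=> n; rewrite asc_gfS.
  by rewrite {1}/a fsumS /asc_gf big_seq1.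
have dE : d = x * (V * d + T).
  have <- : fsum (fun n => gap_gf V n.+1) = V * d + T.
    by rewrite -fsumMl -fsumD; congr fsum; apply/funext=> n; rewrite gap_gfS.
  by rewrite {1}/d fsumS /gap_gf big_seq1 mul0r add0r.
have bE : b = x * (2 * V * b + V * d).
  have <- : fsum (fun n => desc_gf V n.+1) = 2 * V * b + V * d.
    by rewrite -!fsumMl -fsumD; congr fsum; apply/funext=> n; rewrite desc_gfS; ring.
  by rewrite {1}/b fsumS /desc_gf big_seq1 add0r.
have SE : (V - 1) * S = V * (a + b - G).
  rewrite GE -fsumMl -fsumD -fsumN -fsumD -fsumMl; congr fsum.
  by apply/funext=> n; rewrite sum_geo_states.
have TE : (V - 1) ^+ 2 * T = V * (V * (a + b - G) - (V - 1) * H).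
  rewrite GE -fsumMl -fsumD -fsumN -fsumD -!fsumMl -fsumN -fsumD -fsumMl; congr fsum.
  by apply/funext=> n; rewrite sum_wgeo_states.
pose A1 := 1 - x * V; pose A2 := 1 - 2 * x * V.
have w1 : w - x = w * A1 by rewrite /A1 mulrBr mulr1 mulrCA wV mulr1.
have w2 : w - 2 * x = w * A2 by rewrite /A2 mulrBr mulr1 mulrCA wV mulr1.
have w3 : 1 - w = w * (V - 1) by rewrite mulrBr wV mulr1.
(* This is V^4 K(1/V). The factors [A1] and [A2] come from the letters that keep the state: one when
   the flag is off, two when it is on. *)
pose kV := A1 * A2 * (V - 1) ^+ 2 - x * V * A2 * (V - 1) - x ^+ 2 * V ^+ 3.
have kV0 : kV = 0.
  have : w ^+ 4 * kV = 0.
    rewrite -Kw; transitivity ((w - x) * (w - 2 * x) * (1 - w) ^+ 2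
      - x * w * (w - 2 * x) * (1 - w) - x ^+ 2 * w); last by rewrite /kernel; ring.
    rewrite w1 w2 w3; transitivity (w * A1 * (w * A2) * (w * (V - 1)) ^+ 2
      - x * w * (w * V) * (w * A2) * (w * (V - 1)) - x ^+ 2 * w * (w * V) ^+ 3).
      by rewrite /kV; ring.
    by rewrite wV; ring.
  move=> /(congr1 (fun z => V ^+ 4 * z)); rewrite mulr0 mulrA -exprMn.
  by rewrite [V * w]mulrC wV expr1n mul1r.
have aE' : A1 * a = 1 + x * S by rewrite /A1 mulrBl mul1r {1}aE; ring.
have dE' : A1 * d = x * T by rewrite /A1 mulrBl mul1r {1}dE; ring.
have bE' : A2 * b = x * V * d by rewrite /A2 mulrBl mul1r {1}bE; ring.
have main : A2 * (V - 1) ^+ 2 - x * V * A2 * (V - 1) * G - x ^+ 2 * V ^+ 3 * G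
    - x ^+ 2 * V ^+ 2 * (V - 1) * H = 0.
  (* Replacing [A1 * a], [A2 * b], [A1 * d], then [S] and [T], makes every occurrence of [a + b]
     cancel. *)
  transitivity (kV * (a + b)); last by rewrite kV0 mul0r.
  have -> : kV * (a + b) = A2 * (V - 1) ^+ 2 * (A1 * a) + A1 * (V - 1) ^+ 2 * (A2 * b)
    - x * V * A2 * (V - 1) * (a + b) - x ^+ 2 * V ^+ 3 * (a + b) by rewrite /kV; ring.
  rewrite aE' bE'.
  have -> : A1 * (V - 1) ^+ 2 * (x * V * d) = (V - 1) ^+ 2 * x * V * (A1 * d) by ring.
  rewrite dE'.
  transitivity (A2 * (V - 1) ^+ 2 + A2 * (V - 1) * x * ((V - 1) * S)
    + x ^+ 2 * V * ((V - 1) ^+ 2 * T)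
    - x * V * A2 * (V - 1) * (a + b) - x ^+ 2 * V ^+ 3 * (a + b)); last by ring.
  by rewrite SE TE; ring.
rewrite w2 w3 -[RHS](mulr0 (w ^+ 3)) -main.
transitivity ((w * A2) * (w * (V - 1)) ^+ 2 - x * (w * A2) * (w * (V - 1)) * (w * V) * G
   - x ^+ 2 * (w * V) ^+ 3 * G - x ^+ 2 * (w * (V - 1)) * (w * V) ^+ 2 * H); last by ring.
by rewrite wV; ring.
Qed.

End KernelMethod.

(** * The four roots of the kernel and the closed formulas *)

Section Roots.
Variable F : numFieldType.
Local Notation x := (fpsX F).

Lemma kernel_root1 (c : F) : c ^+ 2 + c = 1 -> 1 + c *+ 2 != 0 ->
  exists v : fps F, [/\ kernel v = 0, fcoef v 0 = 1, fcoef v 1 = c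
    & (1 + c *+ 2) * fcoef v 2 = 3 * c + c ^+ 2 - 2 * c ^+ 3].
Proof.
move=> cE u0.
(* These are the coefficients in [y] of K(1 + x y) / x^2. Modulo [x] the polynomial is y^2 + y - 1,
   with derivative 1 + 2 y. *)
have [|| y yc Py] := @fps_hensel_quartic F (-1) (1 - 3 * x) (1 - x)
    (2 * x * (1 - x)) (x ^+ 2) c.
- rewrite !(expr2, fcoefD, fcoefN, fcoefM0, fcoef1, fcoefX, fcoef_nat) /=.
  by transitivity (c ^+ 2 + c - 1); [ring|rewrite cE subrr].
- apply: contraNneq u0; rewrite !(expr2, fcoefD,
    fcoefN, fcoefM0, fcoef1, fcoefX, fcoef_nat) /=.
  by move=> <-; apply/eqP; ring.
exists (1 + x * y); split.
- by rewrite -[RHS](mulr0 (x ^+ 2)) -Py /kernel; ring.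
- by rewrite fcoefD fcoefXM addr0.
- by rewrite fcoefD fcoefXM yc add0r.
have := congr1 (fun f => fcoef f 1) Py.
rewrite [fcoef (1 + _) 2]fcoefD fcoefXM !exprS !expr0.
rewrite !(fcoefD, fcoefN, fcoefM0, fcoefM1, fcoef1, fcoefX, fcoef_nat, yc, fcoef0) /= => E.
by rewrite -[RHS]addr0 -E; ring.
Qed.

Lemma kernel_root0 (c : F) : c ^+ 2 - 3 * c + 2 = 0 -> c *+ 2 - 3 != 0 ->
  exists w : fps F, [/\ kernel w = 0, fcoef w 0 = 0 & fcoef w 1 = c].
Proof.
move=> cE u0.
(* These are the coefficients in [y] of K(x y) / x^2, which is y^2 - 3 y + 2 modulo [x]. *)
have [|| y yc Py] := @fps_hensel_quartic F 2 (- 3 * (1 + x)) (5 * x + 1)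
    (- 2 * x * (x + 1)) (x ^+ 2) c.
- rewrite !(expr2, fcoefD, fcoefN, fcoefM0, fcoef1, fcoefX, fcoef_nat) /= -cE; ring.
- apply: contraNneq u0; rewrite !(expr2, fcoefD,
    fcoefN, fcoefM0, fcoef1, fcoefX, fcoef_nat) /=.
  by move=> <-; apply/eqP; ring.
exists (x * y); split; rewrite ?fcoefXM //.
by rewrite -[RHS](mulr0 (x ^+ 2)) -Py /kernel; ring.
Qed.

Lemma fps_inverse (f : fps F) : fcoef f 0 = 1 -> exists g, f * g = 1.
Proof.
move=> f0; have [|| g _] := @fps_hensel_quartic F (-1) f 0 0 0 1.
- by rewrite !(fcoefN, fcoef0, fcoef1) f0 /=; ring.
- by rewrite !fcoef0 f0 !mul0r !mul0rn !addr0 oner_eq0.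
by rewrite !mul0r !addr0 addrC => /(canRL (subrK _)); rewrite add0r; exists g.
Qed.

Lemma tofrac_quot (g N D : fps F) : D != 0 -> g * D = N ->
  FracField.tofrac g = fps_quot N D.
Proof.
by move=> D0 <-; rewrite /fps_quot tofracM mulfK // tofrac_eq0.
Qed.

Lemma fcoef_neq (f g : fps F) n : fcoef f n != fcoef g n -> f != g.
Proof. by apply: contra => /eqP->. Qed.

Variables v1 v2 w1 w2 : fps F.
Hypotheses (Kv1 : kernel v1 = 0) (Kv2 : kernel v2 = 0).
Hypotheses (Kw1 : kernel w1 = 0) (Kw2 : kernel w2 = 0).
Hypotheses (v10 : fcoef v1 0 = 1) (v20 : fcoef v2 0 = 1).
Hypotheses (w10 : fcoef w1 0 = 0) (w20 : fcoef w2 0 = 0).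
Hypotheses (v12 : v1 != v2) (w12 : w1 != w2).

Let vw (v w : fps F) : fcoef v 0 = 1 -> fcoef w 0 = 0 -> v != w.
Proof. by move=> v0 w0; apply: (@fcoef_neq _ _ 0); rewrite v0 w0 oner_eq0. Qed.

Lemma kernel_vieta :
  [/\ 2 * (x + 1) = v1 + v2 + w1 + w2,
      5 * x + 1 = v1 * v2 + (v1 + v2) * (w1 + w2) + w1 * w2,
      3 * x * (x + 1) = v1 * v2 * (w1 + w2) + w1 * w2 * (v1 + v2)
    & 2 * x ^+ 2 = v1 * v2 * (w1 * w2)].
Proof. by apply: (vieta4 Kv1 Kv2 Kw1 Kw2) => //; apply: vw. Qed.

Lemma kernel_factor v :
  kernel v = (v - v1) * (v - v2) * (v - w1) * (v - w2).
Proof.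
by have [e1 e2 e3 e4] := kernel_vieta; rewrite /kernel e1 e2 e3 e4; ring.
Qed.

Lemma kernel_roots1 v :
  (kernel v = 0 /\ fcoef v 0 = 1) <-> (v = v1 \/ v = v2).
Proof.
split=> [[/eqP + v0]|[->|->]] //.
rewrite kernel_factor !mulf_eq0 !subr_eq0 (negPf (vw v0 w10)) (negPf (vw v0 w20)).
by rewrite !orbF => /orP[]/eqP; [left|right].
Qed.

Lemma kernel_roots0 w :
  (kernel w = 0 /\ fcoef w 0 = 0) <-> (w = w1 \/ w = w2).
Proof.
split=> [[/eqP + w0]|[->|->]] //.
rewrite kernel_factor !mulf_eq0 !subr_eq0 -!(eq_sym v1) -!(eq_sym v2).
rewrite (negPf (vw v10 w0)) (negPf (vw v20 w0)).
by move=> /orP[]/eqP; [left|right].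
Qed.

Let e1 := v1 + v2.
Let e2 := v1 * v2.
Let p := 1 - e1 + e2.
Local Notation g := (invseq_gf F).

(* [fsum (room _)] is eliminated between the kernel equations at [v1], [v2].  *)
Lemma total_gf_eq : x * (total_gf F * (p + x)) = p * (1 + 2 * x - e1).
Proof.
have [V1 h1] := fps_inverse v10; have [V2 h2] := fps_inverse v20.
have E1 := kernel_equation h1 Kv1; have E2 := kernel_equation h2 Kv2.
have v12' : v1 - v2 != 0 by rewrite subr_eq0.
apply: (mulfI v12'); apply/eqP; rewrite -subr_eq0 -oppr_eq0; apply/eqP.
(* In the equation at [w] the unwanted series has coefficient [- x ^+ 2 * (1 - w)], so these weights
   cancel it. What remains is divisible by [v1 - v2]. *)
transitivity ((1 - v2) * 0 - (1 - v1) * 0 : fps F); last by rewrite !mulr0 subrr.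
by rewrite -{1}E1 -E2 /p /e1 /e2; ring.
Qed.

(** Vieta's formulas with [w1 + w2] and [w1 * w2] eliminated give two relations between [e1], [e2]
    and [x]. Modulo these, [total_gf_eq] simplifies, and the new factor [e2 - x * e1] has constant
    term 1. *)
Lemma invseq_gf_eq (px : p + x != 0) : g * (e2 - x * e1) = x * (e1 - 1).
Proof.
have [s1 s2 s3 s4] := kernel_vieta.
have x0 : x != 0 by apply: (@fcoef_neq _ _ 1); rewrite oner_eq0.
suff E : total_gf F * (e2 - x * e1) = e2 - x.
  have -> : g = total_gf F - 1 by rewrite invseq_gfE addrC addKr.
  by rewrite mulrBl E; ring.
apply: (mulfI x0); apply: (mulfI px).
transitivity (x * (total_gf F * (p + x)) * (e2 - x * e1)); first by ring.
rewrite total_gf_eq; apply/eqP; rewrite -subr_eq0; apply/eqP.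
pose f1 := 2 * (x + 1) - e1; pose f2 := 5 * x + 1 - e2 - e1 * f1.
have f1E : f1 = w1 + w2 by rewrite /f1 s1 /e1; ring.
have f2E : f2 = w1 * w2 by rewrite /f2 f1E s2 /e1 /e2; ring.
have r1 : e1 * f2 + e2 * f1 - 3 * x * (x + 1) = 0 by rewrite f1E f2E s3 /e1 /e2; ring.
have r2 : e2 * f2 - 2 * x ^+ 2 = 0 by rewrite f2E s4 /e2; ring.
(* the difference is [(e2 - x) r1 + (1 - e1 + x) r2] *)
transitivity ((e2 - x) * 0 + (1 - e1 + x) * 0 : fps F); last by rewrite !mulr0 addr0.
by rewrite -{1}r1 -r2 /f2 /f1 /p; ring.
Qed.

Lemma invseq_gf_roots1 (px : p + x != 0) :
  FracField.tofrac g = fps_quot (x * (v1 + v2 - 1)) (v1 * v2 - x * (v1 + v2)).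
Proof.
apply: tofrac_quot (invseq_gf_eq px); apply: (@fcoef_neq _ _ 0).
by rewrite fcoefD fcoefN fcoefXM fcoefM0 v10 v20 mulr1 subr0 oner_eq0.
Qed.

(** By Vieta [e2 * (w1 * w2) = 2 * x ^+ 2]. Hence multiplying by [e2] turns the denominator into
    [2 * x * (e2 - x * e1)] and the negated numerator into [2 * x ^+ 2 * (e1 - 1)], so
    [invseq_gf_eq] applies. *)
Lemma invseq_gf_roots0 (px : p + x != 0) : FracField.tofrac g = root_formula w1 w2.
Proof.
have [s1 s2 s3 s4] := kernel_vieta; rewrite /root_formula.
set N := _ * (w1 * w2); set D := _ + 2 * x.
have D0 : D != 0.
  (* The constant term of [D] is 0; its coefficient of [x] is 2, since [w1 * w2] starts in degree
     2. *)
  apply: (@fcoef_neq _ _ 1).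
  rewrite /D !(fcoefD, fcoefN, fcoefM0, fcoefM1, w10, w20, fcoef0).
  rewrite !(fcoef1, fcoefX, fcoef_nat) /= !(mulr0, mul0r, addr0, oppr0, add0r, mulr1).
  by rewrite -[1 + 1]/(2%:R) pnatr_eq0.
rewrite -[RHS]/(- (_ / _)) -mulNr -tofracN; apply: tofrac_quot => //.
have e20 : e2 != 0.
  by apply: (@fcoef_neq _ _ 0); rewrite fcoefM0 v10 v20 mulr1 oner_eq0.
have f1E : w1 + w2 = 2 * (x + 1) - e1 by rewrite s1 /e1; ring.
apply: (mulfI e20).
transitivity (g * (2 * x * e2 - e2 * (w1 * w2) * e1)).
  by rewrite /D f1E; ring.
rewrite /e2 -s4 -/e2; transitivity (2 * x * (g * (e2 - x * e1))); first by ring.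
rewrite invseq_gf_eq //; transitivity (2 * x ^+ 2 * (e1 - 1)); first by ring.
by rewrite s4 /N f1E -/e2; ring.
Qed.

End Roots.

Theorem theorem1 (F : numFieldType) (r5 : F) (r5_gt0 : 0 < r5)
    (r5_sqr : r5 ^+ 2 = 5) :
  (exists v1 v2 w1 w2 : fps F,
    [/\ forall v : fps F,
          (kernel v = 0 /\ fcoef v 0 = 1) <-> (v = v1 \/ v = v2),
        [/\ fcoef v1 0 = 1, fcoef v1 1 = (-1 + r5) / 2
          & fcoef v1 2 = (-5 + 4 * r5) / 5],
        [/\ fcoef v2 0 = 1, fcoef v2 1 = (-1 - r5) / 2
          & fcoef v2 2 = (-5 - 4 * r5) / 5],
        [/\ forall w : fps F,
              (kernel w = 0 /\ fcoef w 0 = 0) <-> (w = w1 \/ w = w2),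
            fcoef w1 1 = 1 & fcoef w2 1 = 2]
      & FracField.tofrac (invseq_gf F) = root_formula w1 w2
        /\ FracField.tofrac (invseq_gf F)
           = fps_quot (fpsX F * (v1 + v2 - 1)) (v1 * v2 - fpsX F * (v1 + v2))])
  /\ [seq fcoef (invseq_gf F) n | n <- iota 0 8]
     = [:: 0; 1; 2; 6; 23; 101; 484; 2468]
  /\ (forall (n : nat) (e : n.-tuple 'I_n), e \in invseq n ->
        (e \in invseq_avoid n pats) <-> sortable (word e)).
Proof.
have root1 (r : F) : r ^+ 2 = 5 -> exists v : fps F,
    [/\ kernel v = 0, fcoef v 0 = 1, fcoef v 1 = (-1 + r) / 2
      & fcoef v 2 = (-5 + 4 * r) / 5].
  move=> rr; have r0 : r != 0 by rewrite -sqrf_eq0 rr pnatr_eq0.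
  (* The derivative at the approximate root is [r] itself, so the root is simple. *)
  have uE : 1 + (-1 + r) / 2 *+ 2 = r by field.
  have [||v [Kv h0 h1 h2]] := @kernel_root1 F ((-1 + r) / 2).
  - transitivity ((r ^+ 2 - 1) / 4); first by field.
    by rewrite rr; field.
  - by rewrite uE.
  exists v; split=> //; apply: (mulfI r0); rewrite -{1}uE h2.
  have -> : r * ((-5 + 4 * r) / 5) = (-5 * r + 4 * r ^+ 2) / 5 by field.
  transitivity ((2 * r * (5 - r ^+ 2) + 8 * r ^+ 2 - 8 * r - 8) / 8); first by field.
  by rewrite rr; field.
split; last split.
- have [v1 [Kv1 v10 v11 v12]] := root1 r5 r5_sqr.
  have [|v2 [Kv2 v20 v21 v22]] := root1 (- r5); first by rewrite sqrrN.
  have [||w1 [Kw1 w10 w11]] := @kernel_root0 F 1.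
  - by ring.
  - by rewrite (_ : _ - _ = -1) ?oppr_eq0 ?oner_eq0 //; ring.
  have [||w2 [Kw2 w20 w21]] := @kernel_root0 F 2.
  - by ring.
  - by rewrite (_ : _ - _ = 1) ?oner_eq0 //; ring.
  have nv : v1 != v2.
    apply: (@fcoef_neq _ _ _ 1); rewrite v11 v21 -subr_eq0.
    by rewrite (_ : _ - _ = r5) ?gt_eqF //; field.
  have nw : w1 != w2.
    apply: (@fcoef_neq _ _ _ 1); rewrite w11 w21 -subr_eq0.
    by rewrite (_ : _ - _ = -1) ?oppr_eq0 ?oner_eq0 //; ring.
  have px : 1 - (v1 + v2) + v1 * v2 + fpsX F != 0.
    (* The first three terms amount to [(1 - v1) * (1 - v2)], which starts in degree 2, so the
       coefficient of [x] is 1. *)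
    apply: (@fcoef_neq _ _ _ 1).
    rewrite !(fcoefD, fcoefN, fcoefM1, fcoef1, fcoefX) v10 v20 /=.
    by rewrite mul1r mulr1 sub0r [fcoef v2 1 + _]addrC addNr add0r oner_eq0.
  exists v1, v2, w1, w2; split=> //.
  + by apply: kernel_roots1 nv nw.
  + by split=> //; rewrite v22; ring.
  + by split=> //; apply: kernel_roots0 nv nw.
  by split; [apply: invseq_gf_roots0 px|apply: (@invseq_gf_roots1 _ _ _ w1 w2)].
- rewrite /= !card_invseq_avoid.
  have -> : size (states 7) = 2468 by vm_compute.
  have -> : size (states 6) = 484 by vm_compute.
  by [].
move=> n e en; rewrite inE en; exact: avoids_sortable.
Qed.
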